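(* Let $X$ be a compact metric space and let $K_n$ ($n\in\mathbb N$) and $K$ be continuous symmetric real kernels on $X\times X$ with $\delta_n=\|K_n-K\|_\infty\to0$. Fix any minimizer $\mu$ of $I_K$ over $\mathcal P(X)$. There is a continuous positive semidefinite kernel $H_\mu$ on $X$ such that, for every sequence $\varepsilon_n>0$ with $\varepsilon_n\to0$ and $\delta_n/\varepsilon_n\to0$, every choice of minimizers $\nu_n$ of $I_{K_n+\varepsilon_nH_\mu}$ over $\mathcal P(X)$ satisfies $\nu_n\rightharpoonup\mu$.
   Context: $\mathcal P(X)$ is the set of Borel probability measures on $X$; $I_K(\mu)=\iint K(x,y)\,d\mu(x)\,d\mu(y)$; $\rightharpoonup$ denotes weak convergence of measures; $\|\cdot\|_\infty$ is the supremum norm on $X\times X$. A symmetric kernel $H$ is positive semidefinite if $\sum_{i,j}c_ic_jH(x_i,x_j)\ge0$ for all finite families $x_i\in X$, $c_i\in\mathbb R$. *)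

(* Defs.v *)
From HB Require Import structures.
From mathcomp Require Import all_boot all_order all_algebra.
From mathcomp Require Import all_classical all_reals all_analysis.

Set Implicit Arguments.
Unset Strict Implicit.
Unset Printing Implicit Defensive.

Import Order.TTheory GRing.Theory Num.Theory.
Import numFieldNormedType.Exports.

Local Open Scope classical_set_scope.
Local Open Scope ring_scope.

(* Measurable types are pointed in MathComp-Analysis, whence the join. A space
   carrying a probability measure is nonempty, so this is no restriction. *)
#[short(type="pointedMetricType")]
HB.structure Definition PointedMetric (R : numDomainType) :=
  {T of Pointed T & Metric R T}.

Notation borelType X := (g_sigma_algebraType (@open X)).

Notation borelProbability X R := (probability (borelType X) R).

Section kernels.
Context {R : realType} {X : pointedMetricType R}.
Implicit Types (K : X * X -> R) (mu : borelProbability X R).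

Definition symmetric_kernel K := forall x y : X, K (x, y) = K (y, x).

Definition psd_kernel K :=
  symmetric_kernel K /\
  forall (m : nat) (x : 'I_m -> X) (c : 'I_m -> R),
    0 <= \sum_(i < m) \sum_(j < m) c i * c j * K (x i, x j).

(* For K bounded and nonempty X (the only case used), the supremum is that of a
   nonempty bounded set, so the default value of sup plays no role. *)
Definition sup_norm K : R := sup [set `|K p| | p in [set: X * X]].

Definition energy K mu : R := \int[mu]_x \int[mu]_y K (x, y).

Definition energy_minimizer K mu :=
  forall nu : borelProbability X R, energy K mu <= energy K nu.

Definition weak_cvg (nu : nat -> borelProbability X R) mu :=
  forall f : X -> R, continuous f -> bounded_fun f ->
    (\int[nu n]_x f x) @[n --> \oo] --> \int[mu]_x f x.

End kernels.

(* Main.v *)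
(* With {phi_k} continuous, [0,1]-valued and of uniformly dense span, and
   h_k = phi_k - int phi_k dmu, take H(x,y) = sum_k 2^-k h_k(x) h_k(y). Its
   energy is I_H(nu) = sum_k 2^-k (int phi_k dnu - int phi_k dmu)^2, which
   vanishes at mu and controls weak convergence to mu. Comparing nu_n with mu in
   the perturbed problem and using I_K(mu) <= I_K(nu_n) gives
   eps_n I_H(nu_n) <= I_{K_n}(mu) - I_{K_n}(nu_n) <= 2 delta_n. *)
Require Import Defs.
From HB Require Import structures.
From mathcomp Require Import all_boot all_order all_algebra.
From mathcomp Require Import all_classical all_reals all_analysis.
From mathcomp Require Import ring lra.
Import Order.TTheory GRing.Theory Num.Theory.
Import numFieldNormedType.Exports.
Local Open Scope classical_set_scope.
Local Open Scope ring_scope.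

(** * Boundedness and uniform continuity on compact spaces *)

Lemma compact_continuous_bounded {R : realType} {T : topologicalType}
    (f : T -> R) :
  compact [set: T] -> continuous f -> exists M, forall x, `|f x| <= M.
Proof.
move=> cT cf.
have /compact_bounded[M [_ /(_ (M + 1))]] : compact (f @` [set: T]).
  by apply: continuous_compact => //; exact: continuous_subspaceT.
by rewrite ltrDl ltr01 => /(_ isT) Mf; exists (M + 1) => x; apply: Mf; exists x.
Qed.

(** Compactness is used as near covering: if near each point every small [d] works, then every small
    [d] works for all points at once. *)
Lemma heine_cantor {R : realType} {X : pseudoMetricType R}
    (f : X -> R) (e : R) : compact [set: X] -> continuous f -> 0 < e ->
  exists2 d, 0 < d & forall x y, ball x d y -> `|f x - f y| <= e.
Proof.
move=> /compact_near_coveringP cX cf e0.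
have nd : \forall d \near 0^'+, [set: X] `<=`
    (fun x => forall y, ball x d y -> `|f x - f y| <= e).
  apply: (cX R (0^'+) (fun d x => forall y, ball x d y -> `|f x - f y| <= e)).
  move=> x _; have e20 : 0 < e / 2 by rewrite divr_gt0.
  have /cvgrPdist_le/(_ _ e20)/nbhs_ballP[r /= r0 rf] := cf x.
  (* Half of [r] is spent on moving the centre from [x] to [x'], the other half on the radius [d],
     so that [y] stays in the ball of radius [r] about [x]. *)
  exists (ball x (r / 2), [set d | d <= r / 2]).
    split; first by apply: nbhsx_ballx; rewrite divr_gt0.
    by apply: nbhs_right_ltW; rewrite divr_gt0.
  move=> [x' d] /= [xx' dr] y x'y.
  have xy : ball x r y.
    rewrite [r]splitr; apply: (ball_triangle xx'); exact: (le_ball dr).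
  have r2r : r / 2 <= r by rewrite [leRHS]splitr lerDl divr_ge0 ?ltW.
  have fy := rf _ xy; have /= fx' := rf x' (le_ball r2r xx').
  by rewrite (le_trans (ler_distD (f x) _ _))// [leRHS]splitr lerD// distrC.
have [d [Pd d0]] := @filter_ex _ _ _ _ (filterI nd (nbhs_right_gt 0)).
by exists d => // x y; exact: Pd.
Qed.

(** * Integrals and energies of continuous functions against Borel probabilities *)

Section integration_on_compact.
Context {R : realType} {X : pointedMetricType R}.
Context (cX : compact [set: X]).
Implicit Types (f g h : X -> R) (mu nu : borelProbability X R).

(** The Borel sets of the line are generated by open intervals, whose preimages are open. *)
Lemma continuous_borel_measurable f : continuous f ->
  measurable_fun [set: borelType X] (f : borelType X -> R).
Proof.
move=> /continuousP cf mT.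
apply: (measurability _ (measurable_realfun.RGenOpens.measurableE R)) => //.
move=> _ [_ [a [b ->] <-]]; rewrite setTI; apply: sub_sigma_algebra; apply: cf.
exact: interval_open.
Qed.

Lemma continuous_integrable mu f : continuous f ->
  mu.-integrable [set: borelType X] (EFin \o (f : borelType X -> R)).
Proof.
move=> cf; apply: measurable_bounded_integrable => //.
- by rewrite /= probability_setT ltry.
- exact: continuous_borel_measurable.
- have [M fM] := compact_continuous_bounded f cX cf.
  by exists M; split; [exact: num_real|move=> B MB x _; exact: le_trans (ltW MB)].
Qed.

(** The total mass is 1, so [c] is its own integral and monotonicity applies. *)
Lemma dist_Rintegral_le mu f g c : continuous f -> continuous g ->
  (forall x, `|f x - g x| <= c) ->
  `|\int[mu]_x f x - \int[mu]_x g x| <= c.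
Proof.
move=> cf cg fgc.
have cfg : continuous (f \- g) by move=> x; apply: cvgB; [exact: cf|exact: cg].
rewrite -RintegralB//; [|exact: continuous_integrable..].
apply: (le_trans (le_normr_Rintegral _ _)) => //.
  exact: (continuous_integrable mu (f \- g)).
have -> : c = \int[mu]_x cst c x.
  by rewrite /= Rintegral_cst//= probability_setT mulr1.
apply: le_Rintegral => //.
- apply: (continuous_integrable mu (fun x => `|f x - g x|)) => x.
  by apply: cvg_norm; exact: cfg.
- by apply: (continuous_integrable mu (cst c)) => x; exact: cvg_cst.
Qed.

Lemma continuous_section (K : X * X -> R) (x : X) :
  continuous K -> continuous (fun y => K (x, y)).
Proof.
move=> cK y; apply: (@continuous_comp _ _ _ (pair x) K); last exact: cK.
by apply: cvg_pair; [exact: cvg_cst|exact: cvg_id].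
Qed.

(** By uniform continuity of [K] on the compact product, nearby [x] and [x'] give sections that are
    uniformly close, hence close integrals. *)
Lemma continuous_potential nu (K : X * X -> R) :
  continuous K -> continuous (fun x : X => \int[nu]_y K (x, y)).
Proof.
move=> cK x; apply/cvgrPdist_le => e e0.
have cXX : compact [set: X * X] by rewrite -setXTT; exact: compact_setX.
have [d d0 Kd] := heine_cantor K e cXX cK e0.
apply/nbhs_ballP; exists d => //= x' xx'.
apply: dist_Rintegral_le => [||y]; [exact: continuous_section..|].
by apply: Kd; split => //=; exact: ballxx.
Qed.

Lemma energyD nu (K L : X * X -> R) : continuous K -> continuous L ->
  energy (fun p => K p + L p) nu = energy K nu + energy L nu.
Proof.
move=> cK cL; rewrite /energy -RintegralD//; last 2 first.
- by apply: continuous_integrable; exact: continuous_potential.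
- by apply: continuous_integrable; exact: continuous_potential.
apply: eq_Rintegral => x _; rewrite RintegralD//.
- by apply: continuous_integrable; exact: continuous_section.
- by apply: continuous_integrable; exact: continuous_section.
Qed.

Lemma energyZ nu (c : R) (K : X * X -> R) : continuous K ->
  energy (fun p => c * K p) nu = c * energy K nu.
Proof.
move=> cK; rewrite /energy -RintegralZl//; last first.
  by apply: continuous_integrable; exact: continuous_potential.
apply: eq_Rintegral => x _; rewrite RintegralZl//.
by apply: continuous_integrable; exact: continuous_section.
Qed.

(** Both factors leave the iterated integral; this is what turns the energy of the constructed
    kernel into a sum of squares. *)
Lemma energy_tensor nu (h : X -> R) : continuous h ->
  energy (fun p => h p.1 * h p.2) nu = (\int[nu]_x h x) ^+ 2.
Proof.
move=> ch; rewrite /energy expr2 -RintegralZr//; last exact: continuous_integrable.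
by apply: eq_Rintegral => x _ /=; rewrite RintegralZl//; exact: continuous_integrable.
Qed.

Lemma dist_energy_le nu (K L : X * X -> R) c : continuous K -> continuous L ->
  (forall p, `|K p - L p| <= c) -> `|energy K nu - energy L nu| <= c.
Proof.
move=> cK cL KLc.
apply: dist_Rintegral_le => [||x]; [exact: continuous_potential..|].
by apply: dist_Rintegral_le => //; exact: continuous_section.
Qed.

(** Compactness bounds the set of values, so [sup] is a true supremum. *)
Lemma le_sup_norm (K : X * X -> R) p : continuous K -> `|K p| <= sup_norm K.
Proof.
move=> cK; have cXX : compact [set: X * X] by rewrite -setXTT; exact: compact_setX.
have [M KM] := compact_continuous_bounded K cXX cK.
by apply: ub_le_sup; [exists M => _ [q _ <-]|exists p].
Qed.

End integration_on_compact.

(** * Finite nets, partitions of unity and a countable family of dense span *)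

Lemma compact_finite_net {R : realType} {X : pointedMetricType R} (r : R) :
  compact [set: X] -> 0 < r ->
  exists s : seq X, forall x, exists2 y, y \in s & ball y r x.
Proof.
rewrite compact_cover => cX r0.
(* Interiors of balls are taken so that the cover is visibly open. *)
have [||D _ DX] := cX _ [set: X] (fun y : X => (ball y r)°).
- by move=> y _; exact: open_interior.
- by move=> y _; exists y => //; exact: nbhsx_ballx.
by exists (finmap.enum_fset D) => x; have [//|y yD /interior_subset] := DX x; exists y.
Qed.

Section partition_of_unity.
Context {R : realType} {X : pointedMetricType R}.
Implicit Types (r : R) (s : seq X) (x y : X).

(** A tent of height [r] at [y], positive exactly on the open [r]-ball. *)
Definition bump r y x : R := Num.max 0 (r - mdist y x).

Definition pou r s y x : R := bump r y x / \sum_(z <- s) bump r z x.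

Lemma bump_ge0 r y x : 0 <= bump r y x.
Proof. by rewrite /bump le_max lexx. Qed.

Lemma bump_gt0 r y x : (0 < bump r y x) = (mdist y x < r).
Proof. by rewrite /bump lt_max ltxx subr_gt0. Qed.

Lemma continuous_mdist y : continuous (fun x => mdist y x : R).
Proof.
move=> x; apply/cvgrPdist_le => e e0.
apply/nbhs_ballP; exists e => //= x'; rewrite ballEmdist /= => /ltW xx'.
rewrite ler_distlC; apply/andP; split.
  rewrite lerBlDr (le_trans (metric_triangle _ x' _))// lerD2l.
  by rewrite metric_sym.
by rewrite (le_trans (metric_triangle _ x _))// lerD2l.
Qed.

Lemma continuous_bump r y : continuous (bump r y).
Proof.
move=> x; apply: (@continuous_max _ _ (cst 0 : X -> R^o) (fun x => r - mdist y x)); first exact: cvg_cst.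
by apply: cvgB; [exact: cvg_cst|exact: continuous_mdist].
Qed.

Context {r : R} {s : seq X} (net : forall x, exists2 y, y \in s & ball y r x).

Lemma sum_bump_gt0 x : 0 < \sum_(z <- s) bump r z x.
Proof.
have [y ys yx] := net x; rewrite (big_rem y)//= ltr_pwDl//.
  by rewrite bump_gt0; move: yx; rewrite ballEmdist.
by apply: sumr_ge0 => z _; exact: bump_ge0.
Qed.

Lemma continuous_pou y : continuous (pou r s y).
Proof.
move=> x; apply: cvgM; first exact: continuous_bump.
apply: cvgV; first by rewrite gt_eqF// sum_bump_gt0.
apply: continuous_big => [|z _]; first exact: add_continuous.
exact: continuous_bump.
Qed.

Lemma pou_ge0 y x : 0 <= pou r s y x.
Proof. by rewrite divr_ge0 ?bump_ge0// ltW// sum_bump_gt0. Qed.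

Lemma pou_le1 y x : y \in s -> pou r s y x <= 1.
Proof.
move=> ys; rewrite ler_pdivrMr ?sum_bump_gt0// mul1r (big_rem y)//= lerDl.
by apply: sumr_ge0 => z _; exact: bump_ge0.
Qed.

Lemma sum_pou x : \sum_(y <- s) pou r s y x = 1.
Proof. by rewrite -mulr_suml divff// gt_eqF// sum_bump_gt0. Qed.

(** Since the weights sum to 1, the error is a convex combination of the differences [f x - f y],
    and only centres [y] within [r] of [x] carry weight. *)
Lemma pou_approx (f : X -> R) (e : R) :
  (forall x y, ball x r y -> `|f x - f y| <= e) ->
  forall x, `|f x - \sum_(y <- s) f y * pou r s y x| <= e.
Proof.
move=> fe x; rewrite -[f x]mulr1 -(sum_pou x) mulr_sumr -sumrB.
rewrite (le_trans (ler_norm_sum _ _ _))// -[leRHS]mulr1 -(sum_pou x) mulr_sumr.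
apply: ler_sum => y _; rewrite -mulrBl normrM (ger0_norm (pou_ge0 _ _)).
have [->|] := eqVneq (pou r s y x) 0; first by rewrite !mulr0.
rewrite mulf_eq0 negb_or => /andP[b0 _]; rewrite ler_wpM2r ?pou_ge0//.
by rewrite distrC fe// ballEmdist /= -bump_gt0 lt_neqAle eq_sym b0 bump_ge0.
Qed.

End partition_of_unity.

(** The partitions of unity attached to 1/(N+1)-nets, for all N, form a countable family. Once
    1/(N+1) is below a modulus of uniform continuity of [f], the N-th one approximates [f], with its
    values at the net points as coefficients. *)
Lemma countable_span_dense {R : realType} {X : pointedMetricType R} :
  compact [set: X] ->
  exists phi : nat -> X -> R,
    [/\ forall k, continuous (phi k), forall k x, 0 <= phi k x <= 1 &
    forall (f : X -> R) (e : R), continuous f -> 0 < e ->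
      exists (I : seq nat) (c : nat -> R),
        forall x, `|f x - \sum_(k <- I) c k * phi k x| <= e].
Proof.
move=> cX.
have /choice[s net] : forall N : nat, exists s : seq X,
    forall x, exists2 y, y \in s & ball y (N.+1%:R^-1 : R) x.
  by move=> N; apply: compact_finite_net cX _; rewrite invr_gt0.
(* The default pair only fills in for numbers that encode no pair; the approximation below uses
   genuine codes. *)
pose ix k : nat * nat := odflt (0, 0)%N (unpickle k).
(* j = (N, i) indexes the bump at the i-th point of a 1/(N+1)-net; it is 0 when
   i is past the end of the net. *)
pose psi (j : nat * nat) (x : X) : R :=
  if (j.2 < size (s j.1))%N
  then pou j.1.+1%:R^-1 (s j.1) (nth point (s j.1) j.2) x else 0.
exists (psi \o ix); split=> [k|k x|f e cf e0].
- rewrite /= /psi; case: (_ < _)%N; last by move=> x; exact: cvg_cst.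
  exact: continuous_pou (net _) _.
- rewrite /= /psi; case: ifP => kN; last by rewrite lexx ler01.
  by apply/andP; split;
    [exact: pou_ge0 (net _) _ _|exact: pou_le1 (net _) _ _ (mem_nth _ _)].
have [d d0 fd] := heine_cantor f e cX cf e0.
have [N /= Nd] : exists N, N.+1%:R^-1 < d.
  by have [N] := ltr_add_invr d0; rewrite add0r; exists N.
exists [seq pickle (N, i) | i <- iota 0 (size (s N))].
exists (fun k => f (nth point (s N) (ix k).2)) => x.
rewrite big_map [X in _ - X](_ : _ =
    \sum_(y <- s N) f y * pou N.+1%:R^-1 (s N) y x).
  apply: pou_approx => // {}x y xy; apply: fd; apply: le_ball xy; exact: ltW.
rewrite [RHS](big_nth point) /index_iota subn0; apply: eq_big_seq => i.
rewrite mem_iota /= add0n => iN.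
by rewrite /ix !pickleK /= /psi /= iN.
Qed.

(** * Series dominated by a geometric one, and uniform limits *)

Lemma le_geometric_tail {R : realType} (a : nat -> R) (N n : nat) :
  (forall k, `|a k| <= 2^-1 ^+ k) ->
  `|\sum_(k < N + n) a k - \sum_(k < N) a k| <=
    2 * 2^-1 ^+ N - 2 * 2^-1 ^+ (N + n).
Proof.
move=> ha; elim: n => [|n IHn]; first by rewrite addn0 !subrr normr0.
(* The bound is the exact value of the geometric sum from [N] to [N + n - 1], so the induction
   closes without loss. *)
rewrite addnS big_ord_recr /= addrAC (le_trans (ler_normD _ _))//.
rewrite (le_trans (lerD IHn (ha _)))// exprS mulrA divff// mul1r.
by rewrite -addrA lerD2l [2 * _]mulr_natl mulr2n opprD subrK.
Qed.

(** Each pointwise series converges absolutely; the tail bound, uniform in [n] and [x], survives in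
    the limit. *)
Lemma weierstrass_M_test {R : realType} {T : Type} (u : nat -> T -> R) :
  (forall k x, `|u k x| <= 2^-1 ^+ k) ->
  exists g : T -> R, forall N x,
    `|g x - \sum_(k < N) u k x| <= 2 * 2^-1 ^+ N.
Proof.
move=> hu; pose S x (N : nat) : R := \sum_(k < N) u k x.
have tail N n x : `|S x (N + n)%N - S x N| <= 2 * 2^-1 ^+ N.
  apply: (le_trans (le_geometric_tail (u ^~ x) N n _)) => //.
  by rewrite gerBl mulr_ge0// exprn_ge0// invr_ge0.
have cS x : cvgn (S x).
  have -> : S x = series (u ^~ x) by apply/funext => N; rewrite /series /= big_mkord.
  apply: normed_cvg; apply: (series_le_cvg (v_ := geometric 1 2^-1)).
  - by move=> n; exact: normr_ge0.
  - by move=> n; rewrite /geometric /= mul1r exprn_ge0// invr_ge0.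
  - by move=> n; rewrite /geometric /= mul1r.
  - by apply: is_cvg_geometric_series; rewrite ger0_norm ?invr_ge0// invf_lt1// ltr1n.
exists (fun x => lim (S x @ \oo)) => N x; apply/ler_addgt0Pr => e e0.
have /cvgrPdist_le/(_ _ e0)[M _ SM] := cS x.
(* The index [N + M] is late enough to be [e]-close to the limit and is covered by [tail] from
   [N]. *)
rewrite (le_trans (ler_distD (S x (N + M)%N) _ _))// addrC lerD//.
by apply: SM => /=; rewrite leq_addl.
Qed.

Lemma geometric_small {R : realType} (e : R) : 0 < e ->
  exists N0, forall N, (N0 <= N)%N -> 2 * 2^-1 ^+ N <= e.
Proof.
move=> e0; have h1 : `|2^-1 : R| < 1.
  by rewrite ger0_norm ?invr_ge0// invf_lt1// ltr1n.
have /cvgrPdist_le/(_ _ e0)[N0 _ hN] := cvg_geometric (2 : R) h1.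
exists N0 => N /hN; rewrite /geometric /= sub0r normrN.
exact: le_trans (ler_norm _).
Qed.

Lemma continuous_uniform_approx {R : realType} {T : topologicalType}
    (g : T -> R) :
  (forall e : R, 0 < e ->
    exists2 h : T -> R, continuous h & forall x, `|g x - h x| <= e) ->
  continuous g.
Proof.
move=> gh x; apply/cvgrPdist_le => e e0.
have e30 : 0 < e / 3 by rewrite divr_gt0.
have [h ch ghe] := gh _ e30.
have /cvgrPdist_le/(_ _ e30) := ch x; apply: filterS => y hxy.
have := ler_distD (h x) (g x) (g y); have := ler_distD (h y) (h x) (g y).
have := ghe x; have := ghe y; rewrite [`|g y - _|]distrC.
lra.
Qed.

(** * The kernel whose energy detects weak convergence to [mu] *)

Section metrizing_kernel.
Context {R : realType} {X : pointedMetricType R}.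
Context (cX : compact [set: X]).

Lemma Rintegral_lincomb (nu : borelProbability X R) (I : seq nat)
    (c : nat -> R) (g : nat -> X -> R) : (forall k, continuous (g k)) ->
  \int[nu]_x (\sum_(k <- I) c k * g k x) = \sum_(k <- I) c k * \int[nu]_x g k x.
Proof.
move=> cg; elim: I => [|k I IHI].
  rewrite big_nil; under eq_Rintegral do rewrite big_nil.
  by rewrite Rintegral_cst// mul0r.
rewrite big_cons; under eq_Rintegral do rewrite big_cons.
have cc i : continuous (fun x : X => c i * g i x).
  by move=> x; apply: cvgM; [exact: cvg_cst|exact: cg].
rewrite RintegralD//; last 2 first.
- exact: (continuous_integrable cX nu (fun x => c k * g k x)).
- apply: (continuous_integrable cX nu (fun x => \sum_(j <- I) c j * g j x)).
  by apply: continuous_big => [|i _]; [exact: add_continuous|exact: cc].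
by rewrite IHI RintegralZl//; exact: (continuous_integrable cX nu (g k)).
Qed.

Lemma energy_sum (nu : borelProbability X R) (N : nat) (u : nat -> X * X -> R) :
  (forall k, continuous (u k)) ->
  energy (fun p => \sum_(k < N) u k p) nu = \sum_(k < N) energy (u k) nu.
Proof.
move=> cu; elim: N => [|N IHN].
  rewrite big_ord0 /energy.
  under eq_Rintegral do under eq_Rintegral do rewrite big_ord0.
  by under eq_Rintegral do rewrite Rintegral_cst// mul0r; rewrite Rintegral_cst// mul0r.
rewrite [RHS]big_ord_recr /= -IHN.
have -> : (fun p => \sum_(k < N.+1) u k p) =
    (fun p => \sum_(k < N) u k p + u N p).
  by apply/funext => p; rewrite big_ord_recr.
apply: (energyD cX); last exact: cu.
by apply: continuous_big => [|i _]; [exact: add_continuous|exact: cu].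
Qed.

(** A uniform approximation of [f] within [e / 3] moves its integral by at most [e / 3] for all
    probabilities simultaneously; the last third comes from convergence on the finite
    combination. *)
Lemma weak_cvg_dense (phi : nat -> X -> R) (nu : nat -> borelProbability X R)
    (mu : borelProbability X R) :
  (forall k, continuous (phi k)) ->
  (forall (f : X -> R) (e : R), continuous f -> 0 < e ->
     exists (I : seq nat) (c : nat -> R),
       forall x, `|f x - \sum_(k <- I) c k * phi k x| <= e) ->
  (forall k, \int[nu n]_x phi k x @[n --> \oo] --> \int[mu]_x phi k x) ->
  weak_cvg nu mu.
Proof.
move=> cphi dense cvphi f cf _; apply/cvgrPdist_le => e e0.
have e30 : 0 < e / 3 by rewrite divr_gt0.
have [I [c fg]] := dense f _ cf e30.
have cg : continuous (fun x => \sum_(k <- I) c k * phi k x).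
  apply: continuous_big => [|k _ x]; first exact: add_continuous.
  by apply: cvgM; [exact: cvg_cst|exact: cphi].
pose gint (la : borelProbability X R) : R :=
  \sum_(k <- I) c k * \int[la]_x phi k x.
have fgi (la : borelProbability X R) : `|\int[la]_x f x - gint la| <= e / 3.
  by rewrite /gint -Rintegral_lincomb//; exact: dist_Rintegral_le.
have : gint (nu n) @[n --> \oo] --> gint mu.
  apply: cvg_big => [|k _]; first exact: add_continuous.
  by apply: cvgM; [exact: cvg_cst|exact: cvphi].
move=> /cvgrPdist_le/(_ _ e30); apply: filterS => n hn.
have := ler_distD (gint mu) (\int[mu]_x f x) (\int[nu n]_x f x).
have := ler_distD (gint (nu n)) (gint mu) (\int[nu n]_x f x).
have := fgi mu; have := fgi (nu n); rewrite [`|_ - gint (nu n)|]distrC.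
lra.
Qed.

Lemma exists_metrizing_kernel (mu : borelProbability X R) :
  exists H : X * X -> R,
    [/\ continuous H, psd_kernel H, energy H mu = 0,
      forall nu : borelProbability X R, 0 <= energy H nu &
      forall nu : nat -> borelProbability X R,
        energy H (nu n) @[n --> \oo] --> 0 -> weak_cvg nu mu].
Proof.
have [phi [cphi phi01 dense]] := countable_span_dense cX.
(* Centring at the mean under [mu] makes every [h k] integrate to 0 against [mu]. *)
pose h k x : R := phi k x - \int[mu]_y phi k y.
have ch k : continuous (h k).
  by move=> x; apply: cvgB; [exact: cphi|exact: cvg_cst].
have int_h k (nu : borelProbability X R) :
    \int[nu]_x h k x = \int[nu]_x phi k x - \int[mu]_x phi k x.
  rewrite RintegralB//; last 2 first.
  - exact: (continuous_integrable cX nu (phi k)).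
  - by apply: (continuous_integrable cX nu (cst _)) => x; exact: cvg_cst.
  by rewrite Rintegral_cst//= probability_setT mulr1.
have h1 k x : `|h k x| <= 1.
  (* The value [phi k x] is rewritten as the integral of a constant, so that [h k x] becomes a
     difference of two integrals of functions with values in [0,1]. *)
  rewrite /h -[X in `|X - _|]mulr1 -[X in _ * X](_ : fine (mu setT) = 1); last first.
    by rewrite probability_setT.
  rewrite -Rintegral_cst//; apply: (dist_Rintegral_le cX) => //.
    by move=> y; exact: cvg_cst.
  move=> y; have /andP[? ?] := phi01 k x; have /andP[? ?] := phi01 k y.
  by rewrite ler_norml; apply/andP; split; lra.
pose u k p : R := 2^-1 ^+ k * (h k p.1 * h k p.2).
have ctensor k : continuous (fun p : X * X => h k p.1 * h k p.2).
  move=> p; apply: cvgM.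
    by apply: (@continuous_comp _ _ _ fst (h k)); [exact: cvg_fst|exact: ch].
  by apply: (@continuous_comp _ _ _ snd (h k)); [exact: cvg_snd|exact: ch].
have cu k : continuous (u k).
  by move=> p; apply: cvgM; [exact: cvg_cst|exact: ctensor].
have cS N : continuous (fun p => \sum_(k < N) u k p).
  by apply: continuous_big => [|k _]; [exact: add_continuous|exact: cu].
have w_ge0 k : 0 <= (2^-1 : R) ^+ k by rewrite exprn_ge0// invr_ge0.
have [|H HS] := weierstrass_M_test u.
  move=> k p; rewrite normrM ger0_norm// ler_piMr// normrM.
  by rewrite -[leRHS]mulr1 ler_pM.
have cH : continuous H.
  apply: continuous_uniform_approx => e /geometric_small[N /(_ N (leqnn N)) Ne].
  by exists (fun p => \sum_(k < N) u k p) => // p; exact: le_trans Ne.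
(* The uniform error of the partial sums passes to energies, which replaces termwise integration of
   the series. *)
have HSE N (nu : borelProbability X R) : `|energy H nu - energy (fun p => \sum_(k < N) u k p) nu|
    <= 2 * 2^-1 ^+ N by exact: dist_energy_le.
have SE N (nu : borelProbability X R) : energy (fun p => \sum_(k < N) u k p) nu =
    \sum_(k < N) 2^-1 ^+ k * (\int[nu]_x h k x) ^+ 2.
  rewrite energy_sum//; apply: eq_bigr => k _.
  by rewrite (energyZ cX)// energy_tensor.
have HE k (nu : borelProbability X R) : 2^-1 ^+ k * (\int[nu]_x h k x) ^+ 2 <= energy H nu.
  apply/ler_addgt0Pr => e /geometric_small[N0 hN].
  (* The truncation lies beyond both [N0], for the error, and [k], so that the [k]-th term occurs;
     the other terms are nonnegative. *)
  have hN' := hN (k.+1 + N0)%N (leq_addl _ _).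
  have := le_trans (HSE (k.+1 + N0)%N nu) hN'; rewrite SE ler_distlC.
  move=> /andP[_]; apply: le_trans.
  have kN : (k < k.+1 + N0)%N by rewrite addSn ltnS leq_addr.
  rewrite (bigD1 (Ordinal kN))//= lerDl sumr_ge0// => i _.
  by rewrite mulr_ge0// sqr_ge0.
have HSc p : \sum_(k < N) u k p @[N --> \oo] --> H p.
  apply/cvgrPdist_le => e /geometric_small[N0 hN].
  by exists N0 => // N /= N0N; rewrite (le_trans (HS N p))// hN.
exists H; split => //.
(* Symmetry and positivity hold for the partial sums and pass to the pointwise limit. *)
- split=> [x y|m x c].
    apply: (cvg_unique _ (HSc (x, y))); first exact: Rhausdorff.
    rewrite (_ : (fun N => _) = (fun N : nat => \sum_(k < N) u k (y, x))).
      exact: HSc.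
    by apply/funext => N; apply: eq_bigr => k _; rewrite /u /= [h k x * _]mulrC.
  pose Q N := \sum_(i < m) \sum_(j < m) c i * c j * \sum_(k < N) u k (x i, x j).
  have : Q N @[N --> \oo] --> \sum_(i < m) \sum_(j < m) c i * c j * H (x i, x j).
    apply: cvg_big => [|i _]; first exact: add_continuous.
    apply: cvg_big => [|j _]; first exact: add_continuous.
    by apply: cvgM; [exact: cvg_cst|exact: HSc].
  move=> /cvgr_to_ge; apply; apply: nearW => N.
  (* Each summand is a rank-one kernel, so its quadratic form is a weighted square. *)
  suff -> : Q N = \sum_(k < N) 2^-1 ^+ k * (\sum_(i < m) c i * h k (x i)) ^+ 2.
    by apply: sumr_ge0 => k _; rewrite mulr_ge0// sqr_ge0.
  rewrite /Q; under eq_bigr do under eq_bigr do rewrite mulr_sumr.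
  under eq_bigr do rewrite exchange_big.
  rewrite exchange_big; apply: eq_bigr => k _ /=.
  rewrite expr2 mulr_suml mulr_sumr; apply: eq_bigr => i _.
  rewrite !mulr_sumr; apply: eq_bigr => j _; rewrite /u /=; ring.
- have E0 N : energy (fun p => \sum_(k < N) u k p) mu = 0.
    rewrite SE big1// => k _; rewrite (_ : \int[mu]_x h k x = 0) ?expr0n ?mulr0//.
    by rewrite int_h subrr.
  apply/eqP; rewrite -normr_le0; apply/ler_addgt0Pr => e.
  move=> /geometric_small[N /(_ N (leqnn N)) Ne].
  by have := HSE N mu; rewrite E0 subr0 add0r => /le_trans; exact.
- by move=> nu; apply: le_trans (HE 0%N nu); rewrite mulr_ge0// sqr_ge0.
move=> nu nuH; apply: (weak_cvg_dense phi) => // k.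
apply/cvgrPdist_le => e e0.
(* With the energy below this threshold, [HE] bounds the square of the integral of [h k] by
   [e ^+ 2]. *)
have d0 : 0 < 2^-1 ^+ k * e ^+ 2 by rewrite mulr_gt0 ?exprn_gt0// invr_gt0.
have /cvgrPdist_le/(_ _ d0) := nuH; apply: filterS => n /=.
rewrite sub0r normrN => /(le_trans (ler_norm _))/(le_trans (HE k (nu n))).
rewrite ler_pM2l ?exprn_gt0 ?invr_gt0// int_h -real_normK ?num_real//.
by rewrite ler_sqr ?nnegrE ?(ltW e0)// distrC.
Qed.

End metrizing_kernel.

(** * Comparison of the perturbed minimizers with [mu] *)

Theorem theorem7p2 (R : realType) (X : pointedMetricType R)
  (hX : compact [set: X])
  (K_ : nat -> X * X -> R) (K : X * X -> R)
  (hK_cont : forall n, continuous (K_ n))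
  (hK_sym : forall n, symmetric_kernel (K_ n))
  (hKcont : continuous K)
  (hKsym : symmetric_kernel K)
  (delta : nat -> R)
  (hdelta : forall n, delta n = sup_norm (fun p => K_ n p - K p))
  (hdelta0 : delta n @[n --> \oo] --> 0)
  (mu : borelProbability X R)
  (hmu : energy_minimizer K mu) :
  exists H : X * X -> R,
    continuous H /\ psd_kernel H /\
    forall eps : nat -> R,
      (forall n, 0 < eps n) ->
      eps n @[n --> \oo] --> 0 ->
      delta n / eps n @[n --> \oo] --> 0 ->
      forall nu : nat -> borelProbability X R,
        (forall n, energy_minimizer (fun p => K_ n p + eps n * H p) (nu n)) ->
        weak_cvg nu mu.
Proof.
have [H [cH psdH Hmu H_ge0 Hweak]] := exists_metrizing_kernel hX mu.
exists H; split=> //; split=> // eps eps0 _ deps nu hnu; apply: Hweak.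
have KnK n la : `|energy (K_ n) la - energy K la| <= delta n.
  apply: (dist_energy_le hX) => // p; rewrite hdelta.
  apply: (le_sup_norm hX (fun p => K_ n p - K p)) => q.
  by apply: cvgB; [exact: hK_cont|exact: hKcont].
have energyKH n la : energy (fun p => K_ n p + eps n * H p) la =
    energy (K_ n) la + eps n * energy H la.
  rewrite (energyD hX)// ?(energyZ hX)// => p.
  by apply: cvgM; [exact: cvg_cst|exact: cH].
(* The factor 2 counts the two exchanges of [K_ n] for [K], one at [mu] and one at [nu n], each
   costing [delta n]; the perturbation vanishes at [mu]. *)
have Hnu n : energy H (nu n) <= 2 * (delta n / eps n).
  rewrite mulrA ler_pdivlMr// mulrC.
  have := hnu n mu; rewrite !energyKH Hmu mulr0 addr0.
  have := hmu (nu n).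
  have := KnK n mu; rewrite ler_distl => /andP[_ h1].
  have := KnK n (nu n); rewrite ler_distl => /andP[+ _]; move: h1.
  move: (energy (K_ n) mu) (energy (K_ n) (nu n)) (energy K mu).
  by move: (energy K (nu n)) (energy H (nu n)) => ? ? ? ? ?; lra.
apply: (@squeeze_cvgr _ _ _ _ (cst 0) (fun n => 2 * (delta n / eps n))).
- by apply: nearW => n; rewrite H_ge0 Hnu.
- exact: cvg_cst.
- by rewrite -(mulr0 2); apply: cvgM => //; exact: cvg_cst.
Qed.
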